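(* If $G$ is a locally universal group, then $G$ does not have the Haagerup property.
   Context: A group $G$ is locally universal if every group embeds into some ultrapower $G^{\mathcal U}$ of $G$ (with $\mathcal U$ an ultrafilter on some index set). The Haagerup property is the usual one for discrete groups. *)

(* Defs.v *)
From HB Require Import structures.
From mathcomp Require Import all_boot all_order all_algebra.
From mathcomp Require Import all_classical reals.
From mathcomp Require Import complex.

Set Implicit Arguments.
Unset Strict Implicit.
Unset Printing Implicit Defensive.

Import Order.TTheory GRing.Theory Num.Theory.

Local Open Scope classical_set_scope.
Local Open Scope quotient_scope.

Section Ultrapower.
Variables (I : Type) (U : set_system I) (UU : UltraFilter U) (G : groupType).

Definition eq_mod_ultra (a b : I -> G) : bool :=
  `[< \forall i \near U, a i = b i >].

Lemma eq_mod_ultra_refl : reflexive eq_mod_ultra.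
Proof. by move=> a; apply/asboolP; apply: nearW. Qed.

Lemma eq_mod_ultra_sym : symmetric eq_mod_ultra.
Proof.
by move=> a b; apply/asboolP/asboolP; apply: filterS => i /esym.
Qed.

Lemma eq_mod_ultra_trans : transitive eq_mod_ultra.
Proof.
move=> b a c /asboolP ab /asboolP bc; apply/asboolP.
by apply: filterS2 ab bc => i -> ->.
Qed.

Canonical eq_mod_ultra_equiv :=
  EquivRel eq_mod_ultra eq_mod_ultra_refl eq_mod_ultra_sym eq_mod_ultra_trans.

(* G^U: sequences in G indexed by I, modulo equality U-almost everywhere. *)
Definition ultrapower := {eq_quot eq_mod_ultra_equiv}.
HB.instance Definition _ := Choice.on ultrapower.

Definition ultra_class (a : I -> G) : ultrapower := \pi a.

Lemma ultra_classP (a b : I -> G) :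
  ultra_class a = ultra_class b <-> \forall i \near U, a i = b i.
Proof.
split; first by move=> /eqmodP/asboolP.
by move=> ab; apply/eqmodP/asboolP.
Qed.

Lemma ultra_repr (a : I -> G) :
  \forall i \near U, repr (ultra_class a) i = a i.
Proof. by apply/ultra_classP; rewrite /ultra_class reprK. Qed.

Definition ultra_mul (x y : ultrapower) : ultrapower :=
  ultra_class (fun i => (repr x i * repr y i)%g).
Definition ultra_one : ultrapower := ultra_class (fun=> 1%g).
Definition ultra_inv (x : ultrapower) : ultrapower :=
  ultra_class (fun i => (repr x i)^-1%g).

Lemma ultra_mulE (a b : I -> G) :
  ultra_mul (ultra_class a) (ultra_class b)
  = ultra_class (fun i => (a i * b i)%g).
Proof.
apply/ultra_classP.
by apply: filterS2 (ultra_repr a) (ultra_repr b) => i -> ->.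
Qed.

Lemma ultra_invE (a : I -> G) :
  ultra_inv (ultra_class a) = ultra_class (fun i => (a i)^-1%g).
Proof. by apply/ultra_classP; apply: filterS (ultra_repr a) => i ->. Qed.

Lemma ultra_classW (x : ultrapower) : exists a, x = ultra_class a.
Proof. by exists (repr x); rewrite /ultra_class reprK. Qed.

Lemma ultra_mulA : associative ultra_mul.
Proof.
move=> x y z; have [a ->] := ultra_classW x; have [b ->] := ultra_classW y.
have [c ->] := ultra_classW z; rewrite !ultra_mulE.
by apply/ultra_classP; apply: nearW => i; rewrite mulgA.
Qed.

Lemma ultra_mul1g : left_id ultra_one ultra_mul.
Proof.
move=> x; have [a ->] := ultra_classW x; rewrite ultra_mulE.
by apply/ultra_classP; apply: nearW => i; rewrite mul1g.
Qed.

Lemma ultra_mulg1 : right_id ultra_one ultra_mul.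
Proof.
move=> x; have [a ->] := ultra_classW x; rewrite ultra_mulE.
by apply/ultra_classP; apply: nearW => i; rewrite mulg1.
Qed.

Lemma ultra_mulVg : left_inverse ultra_one ultra_inv ultra_mul.
Proof.
move=> x; have [a ->] := ultra_classW x; rewrite ultra_invE ultra_mulE.
by apply/ultra_classP; apply: nearW => i; rewrite mulVg.
Qed.

Lemma ultra_mulgV : right_inverse ultra_one ultra_inv ultra_mul.
Proof.
move=> x; have [a ->] := ultra_classW x; rewrite ultra_invE ultra_mulE.
by apply/ultra_classP; apply: nearW => i; rewrite mulgV.
Qed.

HB.instance Definition _ := isGroup.Build ultrapower
  ultra_mulA ultra_mul1g ultra_mulg1 ultra_mulVg ultra_mulgV.

End Ultrapower.

Definition locally_universal (G : groupType) : Prop :=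
  forall H : groupType,
    exists (I : Type) (U : set_system I) (UU : UltraFilter U)
           (f : {multiplicative H -> ultrapower UU G}), injective f.

Local Open Scope ring_scope.
Local Open Scope complex_scope.

Section Haagerup.
Variables (R : realType) (G : groupType).

(* On R[i], 0 <= z means that z is real and nonnegative. *)
Definition positive_definite (phi : G -> R[i]) : Prop :=
  forall (n : nat) (g : 'I_n -> G) (c : 'I_n -> R[i]),
    0 <= \sum_(i < n) \sum_(j < n)
           (Num.conj (c i) * c j * phi ((g i)^-1 * g j)%g).

(* G is discrete, so compact subsets are the finite ones. *)
Definition vanishes_at_infinity (phi : G -> R[i]) : Prop :=
  forall eps : R, 0 < eps -> finite_set [set g : G | eps%:C <= `|phi g|].

Definition directed (I : Type) (le : I -> I -> Prop) : Prop :=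
  [/\ inhabited I,
      (forall i, le i i),
      (forall i j k, le i j -> le j k -> le i k) &
      (forall i j, exists k, le i k /\ le j k)].

Definition net_converges (I : Type) (le : I -> I -> Prop)
    (u : I -> R[i]) (l : R[i]) : Prop :=
  forall eps : R, 0 < eps ->
    exists i0, forall i, le i0 i -> `|u i - l| < eps%:C.

(* A net of normalized positive definite c_0 functions converging pointwise
   to 1. Nets rather than sequences, since G may be uncountable; for countable
   G the two versions agree. *)
Definition haagerup : Prop :=
  exists (I : Type) (le : I -> I -> Prop) (phi : I -> G -> R[i]),
    [/\ directed le,
        (forall i, positive_definite (phi i)),
        (forall i, phi i 1%g = 1),
        (forall i, vanishes_at_infinity (phi i)) &
        (forall g, net_converges le (fun i => phi i g) 1)].

End Haagerup.

(* Main.v *)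
(* In a group G, suppose that a, b, c have order 17 and that each two of them
   generate a quotient of the Heisenberg group over F_17. For averaging
   projections P_a, P_b over <a>, <b> one has the identity
     P_a P_b P_a = P_<a,b> + (1/17) (P_a - P_z P_a),  z = [a, b],
   so the fixed spaces of a and b make an angle of cosine at most
   17^(-1/2) < 1/4, and the Laplacian D = (1 - P_a) + (1 - P_b) + (1 - P_c)
   satisfies D^2 >= (1 - 2/4) D. Iterating 1 - D/3 moves an almost invariant
   vector by a small amount to vectors of arbitrarily small energy; hence a
   positive definite function close to 1 on the powers of a, b, c is at least
   1/2 on <a, b, c>. If G has the Haagerup property then <a, b, c> is therefore
   finite.
   In SL_3(F_17[X]) the elementary matrices e_01(1), e_12(1), e_20(X) satisfy
   these relations and X |-> X^2 maps the group they generate onto a proper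
   subgroup containing e_20(X^2) = [[c, a], [b, c]]. Realising this endomorphism
   as a conjugation inside a group of bijections gives a finite system of
   equations and one inequation that forces <a, b, c> to be infinite; local
   universality transfers its solution to G. *)
From HB Require Import structures.
Require Import Defs.
From mathcomp Require Import all_boot all_order all_algebra reals.
From mathcomp Require Import finmap all_classical complex ring lra zify.
From mathcomp.multinomials Require Import freeg.

Set Implicit Arguments.
Unset Strict Implicit.
Unset Printing Implicit Defensive.

Import Order.TTheory GRing.Theory Num.Theory.

Local Open Scope ring_scope.
Local Open Scope classical_set_scope.

(** * Semi-inner products *)

(** For [P1], [P2] projections and [Q1], [Q2] their complements at a vector [u]: [n] is the square
    norm of [u], [s] and [S] are the sums of square norms of the [P]s and [Q]s, [b] and [c] the
    inner products. The first Cauchy-Schwarz bound gives [s <= (1 + eps) * n], hence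
    [(1 - eps) * n <= S], and the second one converts this into a bound on [c]. *)
Lemma angle_complement_ineq (R : realFieldType) (n s b S c eps : R) :
  0 <= eps < 1 -> 0 <= n -> 0 <= s -> 0 <= S -> 0 <= S + 2 * c ->
  2 * b <= eps * s -> s ^+ 2 <= (s + 2 * b) * n ->
  S = 2 * n - s -> S ^+ 2 <= (S + 2 * c) * n ->
  - eps * S <= 2 * c.
Proof.
move=> /andP[eps_ge0 eps_lt1] n_ge0 s_ge0 S_ge0 W_ge0 b_le cs1 SE cs2.
have s_le : s <= (1 + eps) * n.
  have [->|sN0] := eqVneq s 0; first nra.
  have s_gt0 : 0 < s by rewrite lt_def sN0.
  rewrite -(ler_pM2l s_gt0); nra.
have [S0|SN0] := eqVneq S 0; first nra.
have S_gt0 : 0 < S by rewrite lt_def SN0.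
suff : (1 - eps) * S <= S + 2 * c by lra.
have nS : (1 - eps) * n <= S by lra.
rewrite -(ler_pM2l S_gt0).
have h1 : (1 - eps) * S ^+ 2 <= (S + 2 * c) * ((1 - eps) * n).
  by rewrite [leRHS]mulrCA; apply: ler_wpM2l => //; lra.
have h2 : (S + 2 * c) * ((1 - eps) * n) <= (S + 2 * c) * S by apply: ler_wpM2l.
have := le_trans h1 h2; rewrite expr2; lra.
Qed.

Lemma mean_ineq (R : realFieldType) (x y b eps : R) :
  0 <= eps -> 0 <= x -> 0 <= y -> b ^+ 2 <= eps ^+ 2 * (x * y) ->
  2 * b <= eps * (x + y).
Proof.
move=> eps_ge0 x_ge0 y_ge0 b_le.
have [b_lt0|b_ge0] := ltrP b 0.
  by have := mulr_ge0 eps_ge0 (addr_ge0 x_ge0 y_ge0); lra.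
rewrite -ler_sqr ?nnegrE ?mulr_ge0 ?addr_ge0//.
have : 0 <= eps ^+ 2 * (x - y) ^+ 2 by rewrite mulr_ge0 ?sqr_ge0.
rewrite !exprMn; nra.
Qed.

Section SemiInnerProduct.
Variables (R : realType) (V : lmodType R) (B : V -> V -> R).

Definition semi_inner_product :=
  [/\ forall y, zmod_morphism (B^~ y),
      forall (c : R) x y, B (c *: x) y = c * B x y,
      forall x y, B x y = B y x &
      forall x, 0 <= B x x].

Definition seminorm x := Num.sqrt (B x x).

Hypothesis Bip : semi_inner_product.

Lemma ip_sym x y : B x y = B y x. Proof. by case: Bip. Qed.

Lemma ip_ge0 x : 0 <= B x x. Proof. by case: Bip. Qed.

Lemma ipZl c x y : B (c *: x) y = c * B x y. Proof. by case: Bip. Qed.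

Lemma ipBl x1 x2 y : B (x1 - x2) y = B x1 y - B x2 y.
Proof. by case: Bip => BB _ _ _; exact: (BB y). Qed.

Lemma ip0l y : B 0 y = 0. Proof. by rewrite -(subrr 0) ipBl subrr. Qed.

Lemma ipDl x1 x2 y : B (x1 + x2) y = B x1 y + B x2 y.
Proof. by rewrite -{1}[x2]opprK ipBl -[- x2]sub0r ipBl ip0l sub0r opprK. Qed.

Lemma ipNl x y : B (- x) y = - B x y.
Proof. by rewrite -[- x]sub0r ipBl ip0l sub0r. Qed.

Lemma ip_suml (I : finType) (F : I -> V) y :
  B (\sum_i F i) y = \sum_i B (F i) y.
Proof. by elim/big_rec2: _ => [|i u v _ <-]; rewrite ?ip0l ?ipDl. Qed.

Lemma ipZr c x y : B x (c *: y) = c * B x y.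
Proof. by rewrite ip_sym ipZl ip_sym. Qed.

Lemma ipBr x y1 y2 : B x (y1 - y2) = B x y1 - B x y2.
Proof. by rewrite ip_sym ipBl !(ip_sym x). Qed.

Lemma ipNr x y : B x (- y) = - B x y.
Proof. by rewrite ip_sym ipNl ip_sym. Qed.

Lemma ipDr x y1 y2 : B x (y1 + y2) = B x y1 + B x y2.
Proof. by rewrite ip_sym ipDl !(ip_sym x). Qed.

Lemma cauchy_schwarz x y : B x y ^+ 2 <= B x x * B y y.
Proof.
have quad t : 0 <= B x x + 2 * t * B x y + t ^+ 2 * B y y.
  have := ip_ge0 (x + t *: y).
  rewrite !(ipDl, ipDr, ipZl, ipZr) (ip_sym y x).
  by congr (0 <= _); ring.
have [yy0|yyN0] := eqVneq (B y y) 0; last first.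
  have yy_gt0 : 0 < B y y by rewrite lt_def yyN0 ip_ge0.
  have := quad (- B x y / B y y).
  have -> : B x x + 2 * (- B x y / B y y) * B x y
      + (- B x y / B y y) ^+ 2 * B y y
      = (B x x * B y y - B x y ^+ 2) / B y y by field.
  by rewrite pmulr_lge0 ?invr_gt0// subr_ge0.
rewrite yy0 mulr0; have [->|xyN0] := eqVneq (B x y) 0; first by rewrite expr0n.
(* With [B y y = 0] the quadratic is affine in [t]; this [t] gives it the value -1. *)
have := quad (- (B x x + 1) / (2 * B x y)).
have -> : 2 * (- (B x x + 1) / (2 * B x y)) * B x y = - (B x x + 1) by field.
rewrite yy0; lra.
Qed.

Lemma seminorm_ge0 x : 0 <= seminorm x. Proof. exact: sqrtr_ge0. Qed.

Lemma sqr_seminorm x : seminorm x ^+ 2 = B x x.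
Proof. by rewrite sqr_sqrtr// ip_ge0. Qed.

Lemma seminorm_le x e : 0 <= e -> (seminorm x <= e) = (B x x <= e ^+ 2).
Proof.
by move=> e_ge0; rewrite -sqr_seminorm ler_sqr ?nnegrE ?seminorm_ge0.
Qed.

Lemma seminormD x y : seminorm (x + y) <= seminorm x + seminorm y.
Proof.
rewrite seminorm_le ?addr_ge0 ?seminorm_ge0//.
have xy : B x y <= seminorm x * seminorm y.
  apply: le_trans (ler_norm _) _.
  rewrite -ler_sqr ?nnegrE ?mulr_ge0 ?seminorm_ge0//.
  by rewrite real_normK ?num_real// exprMn !sqr_seminorm cauchy_schwarz.
rewrite !(ipDl, ipDr) (ip_sym y x) sqrrD !sqr_seminorm; lra.
Qed.

Lemma seminormN x : seminorm (- x) = seminorm x.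
Proof. by rewrite /seminorm -scaleN1r ipZl ipZr !mulN1r opprK. Qed.

Lemma seminormB x y : seminorm (x - y) = seminorm (y - x).
Proof. by rewrite -seminormN opprB. Qed.

(* Here [h] plays the role of the projection of [x] on the intersection of the
   two ranges: a small angle cosine between the ranges, off that intersection,
   is inherited by their orthogonal complements. *)
Lemma complement_angle (P1 P2 : V -> V) (h x : V) (eps : R) :
  let u := x - h in
  (forall v w, B (P1 v) w = B (P1 v) (P1 w)) ->
  (forall v w, B (P2 v) w = B (P2 v) (P2 w)) ->
  P1 u = P1 x - h -> P2 u = P2 x - h ->
  0 <= eps < 1 ->
  B (P1 u) (P2 u) ^+ 2 <= eps ^+ 2 * (B (P1 u) (P1 u) * B (P2 u) (P2 u)) ->
  - eps * (B (x - P1 x) (x - P1 x) + B (x - P2 x) (x - P2 x))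
    <= 2 * B (x - P1 x) (x - P2 x).
Proof.
move=> u P1p P2p P1u P2u eps01 b_le.
have eps_ge0 : 0 <= eps by case/andP: eps01.
have Q1 : x - P1 x = u - P1 u by rewrite P1u /u opprB addrA subrK.
have Q2 : x - P2 x = u - P2 u by rewrite P2u /u opprB addrA subrK.
rewrite Q1 Q2; clearbody u; clear Q1 Q2 P1u P2u.
move: (mean_ineq eps_ge0 (ip_ge0 _) (ip_ge0 _) b_le) => {}b_le.
apply: (@angle_complement_ineq _ (B u u)) b_le _ _ _ => //; first exact: ip_ge0.
- by rewrite addr_ge0 ?ip_ge0.
- by rewrite addr_ge0 ?ip_ge0.
- have := ip_ge0 ((u - P1 u) + (u - P2 u)).
  rewrite !(ipDl, ipDr, ipNl, ipNr) !(ip_sym u (P1 u)) !(ip_sym u (P2 u)).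
  rewrite !(ip_sym (P2 u) (P1 u)); lra.
(* By the projection property the inner product of [P1 u + P2 u] with [u] is the sum of the two
   square norms. *)
- have := cauchy_schwarz (P1 u + P2 u) u.
  by rewrite !(ipDl, ipDr) (P1p u u) (P2p u u) (ip_sym (P2 u)); nra.
- rewrite !(ipDl, ipDr, ipNl, ipNr) !(ip_sym u (P1 u)) !(ip_sym u (P2 u)).
  rewrite (P1p u u) (P2p u u); lra.
- have := cauchy_schwarz ((u - P1 u) + (u - P2 u)) u.
  rewrite !(ipDl, ipDr, ipNl, ipNr) !(ip_sym u (P1 u)) !(ip_sym u (P2 u)).
  rewrite !(ip_sym (P2 u) (P1 u)) (P1p u u) (P2p u u).
  set A1 := B (P1 u) (P1 u); set A2 := B (P2 u) (P2 u).
  set b := B (P1 u) (P2 u); set n := B u u; nra.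
Qed.
End SemiInnerProduct.

(** * Averages over cyclic subgroups *)

Section HeisenbergWords.
Variables (G : groupType) (a b z : G).
Hypotheses (ab : (a * b = b * a * z)%g) (za : commute z a) (zb : commute z b).

(** Each of the [i * j] exchanges of a letter [a] with a letter [b] releases one [z]. *)
Lemma heisenberg_expg i j :
  (a ^+ i * b ^+ j = b ^+ j * a ^+ i * z ^+ (i * j))%g.
Proof.
have a1 k : (a * b ^+ k = b ^+ k * a * z ^+ k)%g.
  elim: k => [|k IHk]; first by rewrite !expg0 mulg1 mul1g mulg1.
  rewrite expgSr mulgA IHk -mulgA (commute_sym (commuteX k (commute_sym zb))).
  by rewrite mulgA -(mulgA _ a b) ab !mulgA -mulgA -expgS.
elim: i => [|i IHi]; first by rewrite mul0n !expg0 mul1g !mulg1.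
rewrite expgS -mulgA IHi !mulgA a1 -!mulgA; congr (_ * (_ * _))%g.
rewrite mulgA (commuteX2 j i za) -!mulgA; congr (_ * _)%g.
by rewrite -expgnDr mulSn.
Qed.

End HeisenbergWords.

Section Averaging.
Variables (R : realType) (V : lmodType R) (G : groupType).
Variable act : G -> {linear V -> V}.
Hypotheses (act1 : forall x, act 1%g x = x)
           (actM : forall g h x, act (g * h)%g x = act g (act h x)).
Variable p : nat.
Hypothesis p_prime : prime p.

(** If [s ^+ p = 1], this is the projection onto the vectors fixed by [s], also when [s = 1]; it is
    orthogonal for every invariant form. *)
Definition avg (s : G) (x : V) : V :=
  p%:R^-1 *: \sum_(j < p) act (s ^+ j)%g x.

Let p_neq0 : p%:R != 0 :> R.
Proof. by rewrite pnatr_eq0 -lt0n prime_gt0. Qed.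

Lemma avg_linear s : linear (avg s).
Proof.
move=> c x y; rewrite /avg scalerA mulrC -scalerA -scalerDr; congr (_ *: _).
rewrite scaler_sumr -big_split; apply: eq_bigr => j _.
by rewrite linearP.
Qed.

HB.instance Definition _ s :=
  GRing.isLinear.Build R V V *:%R (avg s) (avg_linear s).

Lemma actX_fix s x j : act s x = x -> act (s ^+ j)%g x = x.
Proof.
by move=> sx; elim: j => [|j IHj]; rewrite ?expg0 ?act1// expgS actM IHj.
Qed.

Lemma avg_fix s x : act s x = x -> avg s x = x.
Proof.
move=> sx; rewrite /avg (eq_bigr (fun=> x)) => [|j _]; last exact: actX_fix.
by rewrite sumr_const card_ord -scaler_nat scalerA mulVf// scale1r.
Qed.

Lemma act_avg s x : (s ^+ p)%g = 1%g -> act s (avg s x) = avg s x.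
Proof.
move=> sp; rewrite /avg linearZ linear_sum /=; congr (_ *: _).
under eq_bigr do rewrite -actM -expgS.
rewrite -(prednK (prime_gt0 p_prime)) big_ord_recr [RHS]big_ord_recl /=.
rewrite (prednK (prime_gt0 p_prime)) sp expg0 addrC; congr (_ + _).
Qed.

Lemma avg_idem s x : (s ^+ p)%g = 1%g -> avg s (avg s x) = avg s x.
Proof. by move=> sp; rewrite avg_fix// act_avg. Qed.

Lemma act_avgC s t x : commute s t -> act t (avg s x) = avg s (act t x).
Proof.
move=> st; rewrite /avg linearZ linear_sum /=; congr (_ *: _).
by apply: eq_bigr => j _; rewrite -!actM (commuteX j (commute_sym st)).
Qed.

Lemma avgC s t x : commute s t -> avg s (avg t x) = avg t (avg s x).
Proof.
move=> st; rewrite {2 3}/avg linearZ linear_sum /=; congr (_ *: _).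
by apply: eq_bigr => j _; rewrite act_avgC//; exact: commuteX.
Qed.

Lemma avg_avg s t x : avg s (avg t x) =
  p%:R^-1 *: (p%:R^-1 *: \sum_(i < p) \sum_(j < p) act (s ^+ i * t ^+ j)%g x).
Proof.
rewrite {1}/avg; congr (_ *: _); rewrite scaler_sumr; apply: eq_bigr => i _.
rewrite linearZ linear_sum /=; congr (_ *: _).
by apply: eq_bigr => j _; rewrite actM.
Qed.

Section HeisenbergAverages.
Variables a b z : G.
Hypotheses (ab : (a * b = b * a * z)%g).
Hypotheses (za : commute z a) (zb : commute z b).
Hypotheses (ap : (a ^+ p = 1)%g) (bp : (b ^+ p = 1)%g) (zp : (z ^+ p = 1)%g).

(** On vectors fixed by [z] the powers of [z] in [heisenberg_expg] disappear, so [a] and [b] act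
    there as commuting elements. *)
Lemma avg_center_comm x :
  avg a (avg b (avg z x)) = avg b (avg a (avg z x)).
Proof.
move: (avg z x) (act_avg x zp) => u zu.
rewrite !avg_avg exchange_big; congr (_ *: (_ *: _)).
apply: eq_bigr => j _; apply: eq_bigr => i _.
by rewrite (heisenberg_expg ab za zb) actM actX_fix.
Qed.

(** As [p] is prime, [z] is a power of [z ^+ i], so both have the same fixed vectors. *)
Lemma avg_expg i x : (0 < i < p)%N -> avg (z ^+ i)%g x = avg z x.
Proof.
move=> /andP[i_gt0 i_ltp]; have zip : ((z ^+ i) ^+ p = 1)%g.
  by rewrite expgnAC zp expg1n.
have zzi : commute z (z ^+ i)%g by apply: commuteX.
have fix_zi : act z (avg (z ^+ i)%g x) = avg (z ^+ i)%g x.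
  have : coprime i p.
    by rewrite coprime_sym prime_coprime// gtnNdvd.
  case: (egcdnP p i_gt0) => k m kmE _ /eqP gcd1.
  have {1}-> : z = (z ^+ i ^+ k)%g.
    by rewrite -expgnA mulnC kmE gcd1 expgnDr mulnC expgnA zp expg1n mul1g.
  by rewrite actX_fix// act_avg.
by rewrite -(avg_fix fix_zi) avgC// [LHS]avg_fix// actX_fix// act_avg.
Qed.

(** On a vector fixed by [a], the element [a ^+ i * b ^+ j] acts as [b ^+ j * (z ^+ j) ^+ i];
    average over [i]. *)
Lemma avg_act_avg j x :
  avg a (act (b ^+ j)%g (avg a x)) = act (b ^+ j)%g (avg (z ^+ j)%g (avg a x)).
Proof.
move: (avg a x) (act_avg x ap) => u au.
rewrite /avg [RHS]linearZ /=; congr (_ *: _).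
rewrite linear_sum; apply: eq_bigr => i _.
rewrite -!actM (heisenberg_expg ab za zb) -mulgA.
by rewrite -(commuteX2 (i * j) i za) !actM (actX_fix _ au) mulnC expgnA.
Qed.

(** In the middle average the term [j = 0] gives [avg a x], and each other term gives [b ^+ j]
    applied to [avg z (avg a x)]. The correction in the first summand completes these to a full
    average over [b]. *)
Lemma avg_conj x : avg a (avg b (avg a x)) =
  p%:R^-1 *: (avg a x - avg z (avg a x)) + avg b (avg z (avg a x)).
Proof.
rewrite {2}/avg linearZ linear_sum /= [X in _ + X]/avg -scalerDr.
congr (_ *: _); rewrite -(prednK (prime_gt0 p_prime)) !big_ord_recl.
rewrite avg_act_avg !expg0 !act1 [avg 1%g _]avg_fix ?act1// addrA subrK.
congr (_ + _); apply: eq_bigr => j _; rewrite avg_act_avg avg_expg// lift0 /=.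
by rewrite -[ltnRHS](prednK (prime_gt0 p_prime)) ltnS.
Qed.

End HeisenbergAverages.

Variable B : V -> V -> R.
Hypothesis Bip : semi_inner_product B.
Hypothesis Bact : forall g x y, B (act g x) (act g y) = B x y.

(** Since [avg s x] is fixed by [s] and [B] is invariant, each translate of [y] has the same inner
    product with it as [y]. *)
Lemma ip_avg s x y : (s ^+ p)%g = 1%g -> B (avg s x) y = B (avg s x) (avg s y).
Proof.
move=> sp; rewrite ip_sym// [RHS]ip_sym// [avg s y in RHS]/avg ipZl// ip_suml//.
rewrite (eq_bigr (fun=> B y (avg s x))) => [|j _]; last first.
  by rewrite -[avg s x](actX_fix j (act_avg x sp)) Bact actX_fix// act_avg.
by rewrite sumr_const card_ord -[X in _ * X]mulr_natl mulKf.
Qed.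

Lemma ip_avgC s x y : (s ^+ p)%g = 1%g -> B (avg s x) y = B x (avg s y).
Proof. by move=> sp; rewrite ip_avg// ip_sym// [RHS]ip_sym// [RHS]ip_avg. Qed.

Definition avg_defect s x := B (x - avg s x) (x - avg s x).

Lemma heisenberg_angle a b z eps x :
  (a * b = b * a * z)%g -> commute z a -> commute z b ->
  (a ^+ p = 1)%g -> (b ^+ p = 1)%g -> (z ^+ p = 1)%g ->
  0 <= eps < 1 -> p%:R^-1 <= eps ^+ 2 ->
  - eps * (avg_defect a x + avg_defect b x)
    <= 2 * B (x - avg a x) (x - avg b x).
Proof.
move=> ab za zb ap bp zp eps01 eps_p.
(* [H] projects onto the vectors fixed by [a], [b] and [z]; the factor [avg z] makes the other two
   commute. *)
pose H y := avg z (avg b (avg a y)).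
have Hba y : H y = avg b (avg a (avg z y)) by rewrite /H !(avgC _ (t := z)).
have Hab y : H y = avg a (avg b (avg z y)).
  by rewrite Hba -(avg_center_comm ab).
have Ha y : avg a (H y) = H y by rewrite Hab avg_idem.
have Hb y : avg b (H y) = H y by rewrite Hba avg_idem.
have HH y : H (H y) = H y by rewrite {1}/H Ha Hb {1}/H avg_idem.
apply: (complement_angle Bip (h := H x)) => //.
- by move=> v w; exact: ip_avg.
- by move=> v w; exact: ip_avg.
- by rewrite linearB /= Ha.
- by rewrite linearB /= Hb.
have : H (x - H x) = 0 by rewrite /H !linearB /= Ha Hb -/(H x) avg_idem ?subrr.
move: (x - H x) => u Hu0.
(* Cauchy-Schwarz reduces the claim to the square norm of [avg b (avg a u)], which is the inner
   product of [avg a (avg b (avg a u))] with [u]. There [avg_conj] applies, and its last term is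
   [H u = 0]. *)
rewrite -[X in B _ X](avg_idem u bp) -ip_avgC//.
apply: le_trans (cauchy_schwarz Bip _ _) _; rewrite mulrA.
apply: ler_wpM2r; first exact: ip_ge0.
rewrite -(ip_avg _ _ bp) -(ip_avgC _ _ ap).
have zu_ge0 : 0 <= B (avg z (avg a u)) u.
  rewrite -[avg a u](avg_idem u ap) -(avgC _ (commute_sym za)).
  rewrite ip_avgC// ip_avg//.
  exact: ip_ge0.
rewrite (avg_conj ab)// [avg b (avg z _)]avgC// -/(H u) Hu0 addr0 ipZl// ipBl//.
rewrite -(ip_avg _ _ ap).
have au_ge0 : 0 <= B (avg a u) u by rewrite ip_avg ?ip_ge0.
apply: (@le_trans _ _ (p%:R^-1 * B (avg a u) u)); last exact: ler_wpM2r.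
by apply: ler_wpM2l; rewrite ?invr_ge0 ?ler0n// gerBl.
Qed.

Lemma avg_defectE s x : (s ^+ p)%g = 1%g -> avg_defect s x = B (x - avg s x) x.
Proof.
move=> sp; rewrite /avg_defect ipBr// -[X in _ - X]ip_avgC// linearB /=.
by rewrite avg_idem// subrr ip0l// subr0.
Qed.

Lemma avg_defect_le s x : (s ^+ p)%g = 1%g -> avg_defect s x <= B x x.
Proof. by move=> sp; rewrite avg_defectE// ipBl// gerBl ip_avg// ip_ge0. Qed.

Lemma seminorm_act g x : seminorm B (act g x) = seminorm B x.
Proof. by rewrite /seminorm Bact. Qed.

(** The fixed part of [x] does not move, and the rest moves by at most twice its seminorm. *)
Lemma act_displacement s x : (s ^+ p)%g = 1%g ->
  seminorm B (act s x - x) <= 2 * Num.sqrt (avg_defect s x).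
Proof.
move=> sp; have -> : act s x - x = act s (x - avg s x) - (x - avg s x).
  by rewrite linearB /= act_avg// opprB addrA subrK.
apply: le_trans (seminormD Bip _ _) _.
by rewrite seminormN// seminorm_act mulr_natl mulr2n.
Qed.

End Averaging.


(** * Spectral gap *)

Section SpectralGap.
Variables (R : realType) (V : lmodType R) (B : V -> V -> R).
Hypothesis Bip : semi_inner_product B.
Variable D : {linear V -> V}.
Hypothesis D_sym : forall x y, B (D x) y = B x (D y).
Hypothesis D_gap : forall x, B (D x) x <= 2 * B (D x) (D x).
Hypothesis D_le3 : forall x, B (D x) x <= 3 * B x x.
Hypothesis D2_le3 : forall x, B (D x) (D x) <= 3 * B (D x) x.

(* [x - D x / 3] multiplies the energy [B (D x) x] by at most
   [5/6 <= (23/25)^2] and moves [x] by at most the square root of its energy;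
   the geometric series [sum_k (23/25)^k = 25/2] bounds the total motion. *)
Lemma descent_step x e : 0 <= e -> B (D x) x <= e ^+ 2 ->
  exists y, seminorm B (y - x) <= e /\ B (D y) y <= (23 / 25 * e) ^+ 2.
Proof.
move=> e_ge0 Ex; exists (x - 3^-1 *: D x); split.
  rewrite addrAC subrr add0r seminormN// seminorm_le// ipZl// ipZr//.
  have := D2_le3 x; have := sqr_ge0 e; lra.
rewrite linearB linearZ /= !(ipDl, ipDr, ipNl, ipNr, ipZl, ipZr)//.
rewrite (D_sym (D x) x).
(* The new energy is [E - 2/3 * d + f/9]. With [f <= 3 * d] and [E <= 2 * d] it is at most
   [E - d/3 <= 5/6 * E]. *)
have := D_gap x; have := D_le3 (D x); have := sqr_ge0 e.
set d := B (D x) (D x); set f := B (D (D x)) (D x); set E := B (D x) x in Ex *.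
rewrite exprMn expr_div_n; lra.
Qed.

Lemma descent k x e : 0 <= e -> B (D x) x <= e ^+ 2 ->
  exists y, seminorm B (y - x) <= 25 / 2 * (1 - (23 / 25) ^+ k) * e
            /\ B (D y) y <= ((23 / 25) ^+ k * e) ^+ 2.
Proof.
move=> e_ge0 Ex; elim: k => [|k [y [yx Ey]]].
  exists x; rewrite subrr subrr mulr0 mul0r mul1r; split => //.
  by rewrite seminorm_le// ip0l// expr0n.
have [|w [wy Ew]] := descent_step _ Ey.
  by rewrite mulr_ge0 ?exprn_ge0 ?divr_ge0.
exists w; split; last by rewrite [_ ^+ k.+1]exprS -mulrA.
have -> : w - x = (w - y) + (y - x) by rewrite addrA subrK.
apply: le_trans (seminormD Bip _ _) _.
apply: le_trans (lerD wy yx) _; rewrite exprS; lra.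
Qed.

End SpectralGap.

Lemma exists_geometric_le1 (R : realType) (l : nat) :
  exists k, l%:R * (23 / 25) ^+ k <= 1 :> R.
Proof.
have bern k : (23 / 25) ^+ k * (1 + k%:R * (2 / 25)) <= 1 :> R.
  elim: k => [|k IHk]; first by rewrite expr0; lra.
  apply: le_trans IHk; rewrite exprSr -mulrA ler_pM2l ?exprn_gt0 ?divr_gt0//.
  have := ler0n R k; rewrite -natr1; nra.
(* The factor 13 is chosen so that [13 * (2 / 25) >= 1]. *)
exists (13 * l)%N; have := bern (13 * l)%N.
have : 0 <= (23 / 25) ^+ (13 * l) :> R by rewrite exprn_ge0 ?divr_ge0.
have := ler0n R l; rewrite natrM; nra.
Qed.

Inductive generated (G : groupType) (S : set G) : G -> Prop :=
| generated_gen g of S g : generated S g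
| generated1 : generated S 1%g
| generatedM g h of generated S g & generated S h : generated S (g * h)%g
| generatedV g of generated S g : generated S g^-1%g.

(** * Three elements that pairwise generate Heisenberg quotients *)

Section Triangle.
Variables (R : realType) (V : lmodType R) (G : groupType).
Variable act : G -> {linear V -> V}.
Hypotheses (act1 : forall x, act 1%g x = x)
           (actM : forall g h x, act (g * h)%g x = act g (act h x)).
Variable B : V -> V -> R.
Hypothesis Bip : semi_inner_product B.
Hypothesis Bact : forall g x y, B (act g x) (act g y) = B x y.
Variable p : nat.
(* [16 <= p] is [1 / p <= (1 / 4) ^+ 2], where 1/4 is the cosine for which
   [laplacian_gap] gets the positive constant [1 - 2 * (1 / 4) = 1 / 2]. *)
Hypotheses (p_prime : prime p) (p_ge16 : (16 <= p)%N).

Definition heisenberg_pair (a b : G) :=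
  [/\ ([~ a, b] ^+ p = 1)%g, commute [~ a, b]%g a & commute [~ a, b]%g b].

Variables a b c : G.
Hypotheses (ap : (a ^+ p = 1)%g) (bp : (b ^+ p = 1)%g) (cp : (c ^+ p = 1)%g).
Hypotheses (ab : heisenberg_pair a b) (bc : heisenberg_pair b c)
           (ca : heisenberg_pair c a).

Local Notation avg := (avg act p).
Local Notation defect := (avg_defect act p B).

Definition laplacian x := (x - avg a x) + (x - avg b x) + (x - avg c x).

Lemma laplacian_linear : linear laplacian.
Proof.
have co s k x y : k *: x + y - avg s (k *: x + y) =
    k *: (x - avg s x) + (y - avg s y).
  by rewrite linearP scalerBr opprD addrACA.
move=> k x y; rewrite /laplacian !co !scalerDr.
by rewrite [RHS]addrACA; congr (_ + _); rewrite [RHS]addrACA.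
Qed.

HB.instance Definition _ :=
  GRing.isLinear.Build R V V *:%R laplacian laplacian_linear.

Lemma laplacian_energy x :
  B (laplacian x) x = defect a x + defect b x + defect c x.
Proof.
rewrite /laplacian !(avg_defectE act1 actM p_prime Bip Bact)//.
by rewrite !(ipDl Bip).
Qed.

Lemma laplacian_sym x y : B (laplacian x) y = B x (laplacian y).
Proof.
by rewrite /laplacian !(ipDl Bip, ipDr Bip, ipNl Bip, ipNr Bip)
  !(ip_avgC act1 actM p_prime Bip Bact).
Qed.

Lemma heisenberg_pair_angle s t x :
  heisenberg_pair s t -> (s ^+ p = 1)%g -> (t ^+ p = 1)%g ->
  - (1 / 4) * (defect s x + defect t x) <= 2 * B (x - avg s x) (x - avg t x).
Proof.
case=> zp zs zt sp tp.
apply: (heisenberg_angle act1 actM p_prime Bip Bact x (commgC s t)) => //.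
  by apply/andP; split; lra.
have : 16 <= p%:R :> R by rewrite ler_nat.
move=> p16; rewrite invf_ple ?posrE; lra.
Qed.

(** Expanding the square norm of the sum of the three defect vectors gives the energy plus three
    cross terms. Each defect enters two of the three pairs, so the cross terms cost at most
    [2 * (1 / 4)] of the energy. *)
Lemma laplacian_gap x :
  B (laplacian x) x <= 2 * B (laplacian x) (laplacian x).
Proof.
have := heisenberg_pair_angle x ab ap bp.
have := heisenberg_pair_angle x bc bp cp.
have := heisenberg_pair_angle x ca cp ap.
rewrite laplacian_energy /laplacian /avg_defect.
move: (x - avg a x) (x - avg b x) (x - avg c x) => u v w.
rewrite !(ipDl Bip, ipDr Bip).
rewrite (ip_sym Bip v u) (ip_sym Bip w v) (ip_sym Bip w u).
lra.
Qed.

Lemma laplacian_le3 x : B (laplacian x) x <= 3 * B x x.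
Proof.
rewrite laplacian_energy.
have := avg_defect_le act1 actM p_prime Bip Bact x ap.
have := avg_defect_le act1 actM p_prime Bip Bact x bp.
have := avg_defect_le act1 actM p_prime Bip Bact x cp.
lra.
Qed.

Lemma laplacian2_le3 x :
  B (laplacian x) (laplacian x) <= 3 * B (laplacian x) x.
Proof.
rewrite laplacian_energy /laplacian /avg_defect.
move: (x - avg a x) (x - avg b x) (x - avg c x) => u v w.
have := ip_ge0 Bip (u - v); have := ip_ge0 Bip (v - w).
have := ip_ge0 Bip (u - w).
rewrite !(ipDl Bip, ipDr Bip, ipNl Bip, ipNr Bip).
rewrite (ip_sym Bip v u) (ip_sym Bip w v) (ip_sym Bip w u).
lra.
Qed.

Lemma generator_displacement s x f : [set a; b; c] s ->
  0 <= f -> B (laplacian x) x <= f ^+ 2 ->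
  seminorm B (act s x - x) <= 2 * f.
Proof.
rewrite laplacian_energy => abc_s f_ge0 Ex.
have d_ge0 t : 0 <= defect t x by exact: ip_ge0.
have [sp ds] : (s ^+ p = 1)%g /\ defect s x <= f ^+ 2.
  have := d_ge0 a; have := d_ge0 b; have := d_ge0 c.
  by case: abc_s => [[->|->]|->]; split => //; lra.
apply: le_trans (act_displacement actM p_prime Bip Bact x sp) _.
rewrite ler_pM2l// -[leRHS]ger0_norm// -sqrtr_sqr ler_sqrt//.
by rewrite sqr_ge0.
Qed.

(** Here [l] is twice the length of a word for [g]. It is chosen before [x], so a descent adapted to
    [l] can absorb it. *)
Lemma generated_displacement g : generated [set a; b; c] g ->
  exists l : nat, forall x f, 0 <= f -> B (laplacian x) x <= f ^+ 2 ->
    seminorm B (act g x - x) <= l%:R * f.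
Proof.
elim=> {g} [s abc_s||g h _ [l gl] _ [m hm]|g _ [l gl]].
- by exists 2%N => x f; exact: generator_displacement.
- exists 0%N => x f f_ge0 _; rewrite act1 subrr mul0r seminorm_le// ip0l//.
  by rewrite expr0n.
- exists (l + m)%N => x f f_ge0 Ex.
  have -> : act (g * h)%g x - x = act g (act h x - x) + (act g x - x).
    by rewrite linearB /= actM addrA subrK.
  apply: le_trans (seminormD Bip _ _) _.
  rewrite (seminorm_act Bact) natrD mulrDl addrC.
  by apply: lerD; [exact: gl|exact: hm].
- exists l => x f f_ge0 Ex.
  have -> : act g^-1%g x - x = act g^-1%g (x - act g x).
    by rewrite linearB /= -actM mulVg act1.
  by rewrite (seminorm_act Bact) seminormB//; exact: gl.
Qed.

(** The bound is uniform in [g]: descend to a [y] whose energy is so small that [g] moves it by at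
    most [e]. As [x] and [y] are at most [25 / 2 * e] apart, the total is [25 / 2 + 1 + 25 / 2 = 26]
    times [e]. *)
Lemma generated_bounded x e g :
  0 <= e -> B (laplacian x) x <= e ^+ 2 -> generated [set a; b; c] g ->
  seminorm B (act g x - x) <= 26 * e.
Proof.
move=> e_ge0 Ex /generated_displacement[l gl].
have [k lk] := exists_geometric_le1 R l.
have [y [yx Ey]] :=
  descent Bip laplacian_sym laplacian_gap laplacian_le3 laplacian2_le3 k
    e_ge0 Ex.
have rk_ge0 : 0 <= (23 / 25) ^+ k :> R by rewrite exprn_ge0 ?divr_ge0.
have yx_le : seminorm B (y - x) <= 25 / 2 * e.
  by have := mulr_ge0 rk_ge0 e_ge0; lra.
have -> : act g x - x = act g (x - y) + ((act g y - y) + (y - x)).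
  by rewrite linearB /= [_ - y + _]addrA subrK addrA subrK.
apply: le_trans (seminormD Bip _ _) _.
rewrite (seminorm_act Bact) seminormB//.
have := seminormD Bip (act g y - y) (y - x).
have := gl _ _ (mulr_ge0 rk_ge0 e_ge0) Ey; rewrite mulrA.
have : l%:R * (23 / 25) ^+ k * e <= e by rewrite ler_piMl.
lra.
Qed.

End Triangle.

(** * Linear maps on free modules *)

Section FreeModule.
Variables (R : realType) (K : choiceType).

Local Notation delta := (fun g : K => << 1 *g g >> : {freeg K / R}).

Lemma fgliftE (M : lmodType R) (f : K -> M) (x : {freeg K / R}) :
  fglift f x = \sum_(z <- dom x) coeff z x *: f z.
Proof.
rewrite -{1}(Freeg_dom x) fglift_Freeg /prelift big_map.
by apply: eq_bigr.
Qed.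

Lemma fglift_linear (M : lmodType R) (f : K -> M) :
  linear (fglift f : {freeg K / R} -> M).
Proof.
have fgliftB := lift_is_additive f.
have fglift0 : fglift f 0 = 0 by rewrite -(subrr 0) fgliftB subrr.
have fgliftD x y : fglift f (x + y) = fglift f x + fglift f y.
  by rewrite -{1}[y]opprK fgliftB -[- y]sub0r fgliftB fglift0 sub0r opprK.
move=> c x y; rewrite fgliftD; congr (_ + _).
rewrite [in RHS]fgliftE scaler_sumr.
rewrite [c *: x]/(fgscale c x) /fgscale.
elim/big_rec2: _ => [|z u v _ <-]; first exact: fglift0.
by rewrite fgliftD liftU scalerA.
Qed.

HB.instance Definition _ (M : lmodType R) (f : K -> M) :=
  GRing.isLinear.Build R {freeg K / R} M *:%R (fglift f) (fglift_linear f).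

Lemma freeg_linear_ext (M : lmodType R) (F F' : {linear {freeg K / R} -> M}) :
  (forall z, F (delta z) = F' (delta z)) -> F =1 F'.
Proof.
move=> FF' x; rewrite -[x]freeg_sumE !linear_sum; apply: eq_bigr => z _.
have -> : << coeff z x *g z >> = coeff z x *: << 1 *g z >> :> {freeg K / R}.
  by apply/eqP/freeg_eqP => w; rewrite coeffZ !coeffU mul1r.
by rewrite !linearZ FF'.
Qed.

End FreeModule.

(** * The regular representation with the form of a positive definite function *)

Section PositiveDefiniteForm.
Variables (R : realType) (G : groupType) (psi : G -> R).

Local Notation V := {freeg G / R}.
Local Notation delta := (fun g : G => << 1 *g g >> : V).

Definition translate (g : G) : {linear V -> V} :=
  fglift (fun h => delta (g * h)%g).

(** This is the Gelfand-Naimark-Segal form, neither divided by its kernel nor completed: all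
    projections used are finite averages, so a semi-inner product suffices. *)
Definition pd_form (x y : V) : R :=
  (fglift (fun h => fglift (fun k => psi (h^-1 * k)%g : R^o) y : R^o) x : R^o).

Lemma translate_delta g h : translate g (delta h) = delta (g * h)%g.
Proof. by rewrite /= liftU scale1r. Qed.

Lemma translate1 x : translate 1%g x = x.
Proof.
apply: (freeg_linear_ext (F' := idfun)) => z.
by rewrite translate_delta mul1g.
Qed.

Lemma translateM g h x :
  translate (g * h)%g x = translate g (translate h x).
Proof.
apply: (freeg_linear_ext (F' := translate g \o translate h)) => z.
by rewrite [RHS]/= !translate_delta mulgA.
Qed.

Lemma pd_form_delta g h : pd_form (delta g) (delta h) = psi (g^-1 * h)%g.
Proof. by rewrite /pd_form !liftU !scale1r. Qed.

Lemma pd_formE x y : pd_form x y =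
  \sum_(g <- dom x) \sum_(h <- dom y)
    coeff g x * coeff h y * psi (g^-1 * h)%g.
Proof.
rewrite /pd_form fgliftE; apply: eq_bigr => g _.
rewrite fgliftE scaler_sumr; apply: eq_bigr => h _.
by rewrite scalerA.
Qed.

Lemma pd_formC x y :
  (forall g, psi g^-1%g = psi g) -> pd_form x y = pd_form y x.
Proof.
move=> psiV; rewrite !pd_formE exchange_big; apply: eq_bigr => h _.
apply: eq_bigr => g _.
by rewrite -[in RHS]psiV invgM invgK [coeff h y * _]mulrC.
Qed.

Hypothesis psiV : forall g, psi g^-1%g = psi g.
Hypothesis psi_pd : forall n (g : 'I_n -> G) (c : 'I_n -> R),
  0 <= \sum_i \sum_j c i * c j * psi ((g i)^-1 * g j)%g.

Lemma pd_form_sip : semi_inner_product pd_form.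
Proof.
split=> [y u v|c x y|x y|x].
- by rewrite /pd_form linearB.
- by rewrite /pd_form linearZ.
- exact: pd_formC.
rewrite pd_formE big_tnth.
under eq_bigr do rewrite big_tnth.
exact: psi_pd.
Qed.

Lemma pd_form_translate g x y :
  pd_form (translate g x) (translate g y) = pd_form x y.
Proof.
pose f h := fglift (fun k => psi (h^-1 * k)%g : R^o) : {linear V -> R^o}.
have fg h z : f (g * h)%g (translate g z) = f h z.
  apply: (freeg_linear_ext (F := f (g * h)%g \o translate g)) => k.
  rewrite [LHS]/= translate_delta /f liftU [RHS]liftU !scale1r.
  by rewrite invgM -mulgA mulKg.
pose F z := fglift (fun h => f h z) : {linear V -> R^o}.
have Fg h : (F (translate g y) \o translate g) (delta h) = F y (delta h).
  by rewrite [LHS]/= translate_delta /F liftU [RHS]liftU !scale1r; exact: fg.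
exact: (@freeg_linear_ext _ _ _ (F (translate g y) \o translate g) (F y) Fg x).
Qed.

Hypothesis psi1 : psi 1%g = 1.

Variables a b c : G.
Hypotheses (a17 : (a ^+ 17 = 1)%g) (b17 : (b ^+ 17 = 1)%g)
           (c17 : (c ^+ 17 = 1)%g).
Hypotheses (ab : heisenberg_pair 17 a b) (bc : heisenberg_pair 17 b c)
           (ca : heisenberg_pair 17 c a).

(** Each defect of [v] is an average of the numbers [1 - psi (s ^+ j)], so the energy is at most
    [3 / 3000 <= (1 / 26) ^+ 2]. Hence [g] moves [v] by at most 1, and the square of this
    displacement is [2 - 2 * psi g]. *)
Lemma positive_definite_generated g :
  (forall s j, [set a; b; c] s -> 1 - psi (s ^+ j)%g <= 1 / 3000) ->
  generated [set a; b; c] g -> 1 / 2 <= psi g.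
Proof.
move=> psi_near1 abc_g; pose v := delta 1%g.
have prime17 : prime 17 by [].
have defect_v s : (s ^+ 17 = 1)%g -> [set a; b; c] s ->
    avg_defect translate 17 pd_form s v <= 1 / 3000.
  move=> s17 abc_s.
  rewrite (avg_defectE translate1 translateM prime17 pd_form_sip
    pd_form_translate)//.
  have -> : v - avg translate 17 s v =
      17%:R^-1 *: \sum_(j < 17) (v - translate (s ^+ j)%g v).
    rewrite sumrB sumr_const card_ord scalerBr -[v *+ _]scaler_nat scalerA.
    by rewrite mulVf ?pnatr_eq0// scale1r.
  rewrite ipZl ?ip_suml//; try exact: pd_form_sip.
  have : \sum_(j < 17) pd_form (v - translate (s ^+ j)%g v) v <=
         \sum_(j < 17) 1 / 3000 :> R.
    apply: ler_sum => j _; rewrite ipBl; last exact: pd_form_sip.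
    rewrite /v translate_delta !pd_form_delta invg1 mul1g psi1 mulg1 mulg1 psiV.
    exact: psi_near1.
  rewrite sumr_const card_ord -mulr_natl; lra.
have Ev : pd_form (laplacian translate 17 a b c v) v <= (1 / 26) ^+ 2.
  rewrite (laplacian_energy translate1 translateM pd_form_sip
    pd_form_translate)//.
  have := defect_v a a17; have := defect_v b b17; have := defect_v c c17.
  rewrite expr_div_n.
  have [Sa Sb Sc] : [/\ [set a; b; c] a, [set a; b; c] b & [set a; b; c] c].
    by split => /=; [left; left|left; right|right].
  by move=> /(_ Sc) ? /(_ Sb) ? /(_ Sa) ?; lra.
have := generated_bounded translate1 translateM pd_form_sip pd_form_translate
  prime17 isT  a17 b17 c17 ab bc ca _ Ev abc_g.
have -> : 26 * (1 / 26) = 1 :> R by field.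
rewrite seminorm_le//; last exact: pd_form_sip.
rewrite divr_ge0// => /(_ isT).
have := pd_form_sip => sip.
rewrite !(ipDl sip, ipDr sip, ipNl sip, ipNr sip) pd_form_translate.
rewrite /v translate_delta !pd_form_delta invg1 !mulg1 mul1g psi1 psiV expr1n.
lra.
Qed.

End PositiveDefiniteForm.

(** * The Haagerup property *)

Lemma finite_inj_surj (T : choiceType) (A : set T) (f : T -> T) :
  finite_set A -> injective f -> (forall x, A x -> A (f x)) ->
  forall y, A y -> exists2 x, A x & f x = y.
Proof.
move=> finA f_inj fA y Ay.
have finP x : x \in fset_set A <-> A x.
  by rewrite in_fset_set//; split=> [/set_mem|/mem_set].
have /eqP fAE : (f @` fset_set A)%fset == fset_set A.
  rewrite eqEfcard card_imfset// leqnn andbT.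
  by apply/fsubsetP => _ /imfsetP[x /finP Ax ->]; apply/finP; exact: fA.
by move: Ay => /finP; rewrite -fAE => /imfsetP[x /finP Ax ->]; exists x.
Qed.

Section RealPart.
Local Open Scope complex_scope.
Variable R : realType.

Lemma Re_sum (I : finType) (F : I -> R[i]) :
  complex.Re (\sum_i F i) = \sum_i complex.Re (F i).
Proof.
by elim/big_rec2: _ => //= i x y _ <-; case: (F i) => u v; case: y => u' v'.
Qed.

Lemma Re_scale (r : R) (z : R[i]) : complex.Re (r%:C * z) = r * complex.Re z.
Proof. by case: z => u v /=; rewrite mul0r subr0. Qed.

Lemma Re_le_normc (z : R[i]) : (complex.Re z)%:C <= `|z|.
Proof.
rewrite normc_def lecR; apply: le_trans (ler_norm _) _.
by rewrite -sqrtr_sqr ler_wsqrtr// lerDl sqr_ge0.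
Qed.

Section SymmetricRealPart.
Variables (G : groupType) (phi : G -> R[i]).

(* Averaging over inversion makes symmetry free, without changing the
   quadratic form with real coefficients. *)
Definition sym_Re (g : G) : R :=
  (complex.Re (phi g) + complex.Re (phi g^-1%g)) / 2.

Lemma sym_ReV g : sym_Re g^-1%g = sym_Re g.
Proof. by rewrite /sym_Re invgK addrC. Qed.

Lemma sym_Re1 : phi 1%g = 1 -> sym_Re 1%g = 1.
Proof. by rewrite /sym_Re invg1 => -> /=; lra. Qed.

Lemma sym_Re_pd : positive_definite phi ->
  forall n (g : 'I_n -> G) (c : 'I_n -> R),
  0 <= \sum_i \sum_j c i * c j * sym_Re ((g i)^-1 * g j)%g.
Proof.
move=> pd n g c.
have := pd n g (fun i => (c i)%:C); rewrite lecE => /andP[_].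
rewrite Re_sum.
under eq_bigr => i _.
  rewrite Re_sum; under eq_bigr => j _.
    rewrite conj_Creal ?complex_real// -rmorphM Re_scale.
    over.
  over.
set S := (X in 0 <= X -> _) => S_ge0; apply: le_trans S_ge0 _.
rewrite le_eqVlt; apply/orP; left; apply/eqP.
(* Exchanging [i] and [j] inverts the argument of [phi]. *)
have SE : S = \sum_i \sum_j c i * c j * complex.Re (phi ((g i)^-1 * g j)^-1%g).
  rewrite /S exchange_big; apply: eq_bigr => i _; apply: eq_bigr => j _.
  by rewrite invgM invgK [c j * _]mulrC.
transitivity ((S + S) / 2); first by lra.
rewrite {2}SE /S -big_split mulr_suml; apply: eq_bigr => i _.
rewrite -big_split mulr_suml; apply: eq_bigr => j _.
by rewrite /sym_Re /=; lra.
Qed.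

Lemma sym_Re_near1 g e : `|phi g - 1| < e%:C -> `|phi g^-1%g - 1| < e%:C ->
  1 - sym_Re g <= e.
Proof.
have near1 z : `|z - 1| < e%:C -> 1 - complex.Re z <= e.
  rewrite distrC => /ltW h; have := le_trans (Re_le_normc _) h.
  by rewrite lecR; case: z {h}.
by rewrite /sym_Re => /near1 ? /near1 ?; lra.
Qed.

(** If the mean is at least [e], so is the real part at [g] or at [g^-1]; the set lies in the union
    of a finite set and its inverse. *)
Lemma sym_Re_finite e : 0 < e ->
  vanishes_at_infinity phi -> finite_set [set g | e <= sym_Re g].
Proof.
move=> e_gt0 /(_ e e_gt0) fin.
pose S := [set g : G | e%:C <= `|phi g|].
apply: (@sub_finite_set _ _ (S `|` (fun g => g^-1%g) @` S)); last first.
  by rewrite finite_setU; split => //; exact: finite_image.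
move=> g /=; rewrite /sym_Re => e_le.
have [h|h] := lerP e (complex.Re (phi g)).
  by left; apply: le_trans (Re_le_normc _); rewrite lecR.
right; exists g^-1%g; last by rewrite invgK.
by apply: le_trans (Re_le_normc _); rewrite lecR; lra.
Qed.

End SymmetricRealPart.

Lemma directed_seq (I : Type) (le : I -> I -> Prop) (T : eqType) (s : seq T)
    (P : I -> T -> Prop) : directed le ->
  (forall t, exists i0, forall i, le i0 i -> P i t) ->
  exists i, forall t, t \in s -> P i t.
Proof.
case=> [[i0] lexx le_tr le_dir] ev.
suff [i iP] : exists i0, forall i, le i0 i -> forall t, t \in s -> P i t.
  by exists i => t; exact: iP.
elim: s => [|t s [i1 IH]]; first by exists i0.
have [i2 i2P] := ev t; have [i3 [le13 le23]] := le_dir i1 i2.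
exists i3 => i le3i u; rewrite inE => /orP[/eqP ->|].
  by apply: i2P; apply: le_tr le3i.
by apply: IH; apply: le_tr le3i.
Qed.

(** One member of the net is close to 1 on the finitely many powers of [a], [b], [c] and their
    inverses. Its symmetrized real part is then at least 1/2 on the generated subgroup, which
    vanishing at infinity makes finite. *)
Lemma haagerup_generated_finite (G : groupType) (a b c : G) :
  haagerup R G ->
  (a ^+ 17 = 1)%g -> (b ^+ 17 = 1)%g -> (c ^+ 17 = 1)%g ->
  heisenberg_pair 17 a b -> heisenberg_pair 17 b c -> heisenberg_pair 17 c a ->
  finite_set (generated [set a; b; c]).
Proof.
case=> I [le [phi [dir pd phi1 c0 cvg]]] a17 b17 c17 ab bc ca.
pose pows := [seq (s ^+ j)%g | s <- [:: a; b; c], j <- iota 0 17].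
pose P i (g : G) := `|phi i g - 1| < (1 / 3000)%:C.
have eps_gt0 : 0 < 1 / 3000 :> R by lra.
have [i iP] := directed_seq (pows ++ [seq g^-1%g | g <- pows]) dir
  (fun g => cvg g _ eps_gt0) : exists i, forall g, _ -> P i g.
have half_gt0 : 0 < 1 / 2 :> R by lra.
apply: sub_finite_set (sym_Re_finite half_gt0 (c0 i)) => g.
apply: (positive_definite_generated (sym_ReV _) (sym_Re_pd (pd i))
  (sym_Re1 (phi1 i)) a17 b17 c17 ab bc ca).
move=> s j abc_s.
have s17 : (s ^+ 17 = 1)%g by case: abc_s => [[->|->]|->].
have sj : (s ^+ j)%g \in pows.
  have -> : (s ^+ j = s ^+ (j %% 17))%g.
    by rewrite {1}(divn_eq j 17) expgnDr mulnC expgnA s17 expg1n mul1g.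
  apply/allpairsP; exists (s, j %% 17)%N; split => //.
    by rewrite /=; case: abc_s => [[->|->]|->]; rewrite !inE eqxx ?orbT.
  by rewrite mem_iota ltn_mod.
by apply: sym_Re_near1; apply: iP; rewrite mem_cat ?sj// map_f ?orbT.
Qed.

End RealPart.

(** * Equations transferred by ultrapowers *)

(** The identity is expressed as [Exp w 0]. *)
Inductive word : Type :=
| Var of nat
| Mul of word & word
| Inv of word
| Exp of word & nat.

Fixpoint eval (G : groupType) (rho : nat -> G) (w : word) : G :=
  match w with
  | Var n => rho n
  | Mul u v => eval rho u * eval rho v
  | Inv u => (eval rho u)^-1
  | Exp u n => eval rho u ^+ n
  end%g.

Definition holds (G : groupType) (rho : nat -> G) (eqs : seq (word * word)) :=
  foldr (fun e P => eval rho e.1 = eval rho e.2 /\ P) True eqs.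

Lemma multiplicative1 (G H : groupType) (f : {multiplicative G -> H}) :
  f 1%g = 1%g.
Proof. by apply: (mulgI (f 1%g)); rewrite -gmulfM !mulg1. Qed.

Section Transfer.
Variables (G H : groupType) (I : Type) (U : set_system I) (UU : UltraFilter U).
Variable f : {multiplicative H -> ultrapower UU G}.

Let coord (x : H) (i : I) : G := repr (f x) i.

Lemma coordM x y :
  \forall i \near U, coord (x * y)%g i = (coord x i * coord y i)%g.
Proof. by rewrite /coord gmulfM; exact: ultra_repr. Qed.

Lemma coord1 : \forall i \near U, coord 1%g i = 1%g.
Proof. by rewrite /coord multiplicative1; exact: ultra_repr. Qed.

Lemma coordV x : \forall i \near U, coord x^-1%g i = (coord x i)^-1%g.
Proof.
have -> : coord x^-1%g = repr (f x)^-1%g.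
  rewrite /coord -[(f x)^-1%g]mulg1 -(multiplicative1 f) -(mulgV x) gmulfM.
  by rewrite mulKg.
exact: ultra_repr.
Qed.

(** The chosen representatives are multiplicative only almost everywhere for each pair; a word
    involves finitely many operations, so finitely many sets of [U] are intersected. *)
Lemma coord_eval (rho : nat -> H) w :
  \forall i \near U, coord (eval rho w) i = eval (fun n => coord (rho n) i) w.
Proof.
elim: w => /= [n|u IHu v IHv|u IHu|u IHu n]; first exact: nearW.
- by apply: filterS3 (coordM (eval rho u) (eval rho v)) IHu IHv => i -> -> ->.
- by apply: filterS2 (coordV (eval rho u)) IHu => i -> ->.
- elim: n => [|n IHn]; first exact: coord1.
  rewrite expgS.
  apply: filterS3 (coordM (eval rho u) (eval rho u ^+ n)%g) IHu IHn.
  move=> i -> -> ->.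
  by rewrite expgS.
Qed.

Lemma holds_coord (rho : nat -> H) eqs : holds rho eqs ->
  \forall i \near U, holds (fun n => coord (rho n) i) eqs.
Proof.
elim: eqs => [_|[u v] eqs IH [/= uv /IH {}IH]]; first exact: nearW.
have := coord_eval rho u; rewrite uv => Eu.
by apply: filterS3 Eu (coord_eval rho v) IH => i -> ->.
Qed.

End Transfer.

(** The equations hold at almost every index. For the inequation, the ultrafilter contains the
    agreement set [E] or its complement, and [E] is excluded by injectivity of the embedding. Any
    index common to these sets gives a solution in [G]. *)
Lemma locally_universal_transfer (G H : groupType) (rho : nat -> H) eqs u v :
  locally_universal G -> holds rho eqs -> eval rho u <> eval rho v ->
  exists sigma : nat -> G, holds sigma eqs /\ eval sigma u <> eval sigma v.
Proof.
move=> /(_ H)[I [U [UU [f f_inj]]]] eqsP uv.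
pose E := [set i | repr (f (eval rho u)) i = repr (f (eval rho v)) i].
have uvN : \forall i \near U, ~ E i.
  have [uvE|//] := in_ultra_setVsetC E UU; case: uv; apply: f_inj.
  by rewrite -[LHS]reprK -[RHS]reprK; apply/ultra_classP.
have [i [iP [iu [iv iuv]]]] := filter_ex (filterI (holds_coord f eqsP)
  (filterI (coord_eval f rho u) (filterI (coord_eval f rho v) uvN))).
exists (fun n => repr (f (rho n)) i); split => //.
by rewrite -iu -iv; exact: iuv.
Qed.

(** * A configuration that forces an infinite subgroup *)

Section Configuration.
Variables (G : groupType) (a b c t y : G).

(* [t] conjugates the group generated by [a], [b], [c] into itself, and [y]
   witnesses that the image is a proper subgroup. *)
Lemma self_similar_infinite :
  commute t a -> commute t b ->
  (t * c = [~ [~ c, a], [~ b, c]] * t)%g ->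
  commute y a -> commute y b -> commute y c -> 
  ~ commute y (t^-1 * c * t)%g ->
  infinite_set (generated [set a; b; c]).
Proof.
move=> ta tb tc ya yb yc yN fin.
have ab_c : [set a; b; c] c by right.
have gen s : [set a; b; c] s -> generated [set a; b; c] s.
  exact: generated_gen.
have genR g h : generated [set a; b; c] g -> generated [set a; b; c] h ->
    generated [set a; b; c] [~ g, h]%g.
  by move=> gg gh; do !apply: generatedM => //; apply: generatedV.
have conj_gen g : generated [set a; b; c] g ->
    generated [set a; b; c] (t * g * t^-1)%g.
  elim=> {g} [s [[->|->]|->]||g h _ IHg _ IHh|g _ IHg].
  - by rewrite ta mulgK; apply: gen; left; left.
  - by rewrite tb mulgK; apply: gen; left; right.
  - rewrite tc mulgK; apply/genR; apply/genR; apply: gen => /=; tauto.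
  - by rewrite mulg1 mulgV; exact: generated1.
  - have -> : (t * (g * h) * t^-1 = (t * g * t^-1) * (t * h * t^-1))%g.
      by rewrite !mulgA mulgVK.
    exact: generatedM.
  - have -> : (t * g^-1 * t^-1 = (t * g * t^-1)^-1)%g.
      by rewrite !invgM invgK mulgA.
    exact: generatedV.
have conj_inj : injective (fun g : G => t * g * t^-1)%g.
  by move=> g h /mulIg/mulgI.
(* In a finite subgroup the injective conjugation is onto, so [t^-1 * c * t] lies in it and commutes
   with [y]. *)
have [g gen_g gc] := finite_inj_surj fin conj_inj conj_gen (gen _ ab_c).
apply: yN; rewrite -gc !mulgA mulVg mul1g mulgVK.
elim: gen_g => {g gc} [s [[->|->]|->]||g h _ yg _ yh|g _ yg] //.
- exact: commute1.
- exact: commuteM.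
- exact: commuteV.
Qed.

End Configuration.

(** * The group of bijections of a type *)

Record selfbij (T : Type) := Selfbij {
  fwd :> T -> T;
  bwd : T -> T;
  fwdK : cancel fwd bwd;
  bwdK : cancel bwd fwd }.

HB.instance Definition _ (T : Type) := gen_eqMixin (selfbij T).
HB.instance Definition _ (T : Type) := gen_choiceMixin (selfbij T).

Section SelfBijections.
Variable T : Type.
Implicit Types f g h : selfbij T.

Lemma selfbij_ext f g : fwd f =1 fwd g -> f = g.
Proof.
case: f g => [f f' fK f'K] [g g' gK g'K] /= /funext fg; subst g.
have f'g' : f' = g' by apply/funext => x; rewrite -{1}[x]g'K fK.
by subst g'; congr Selfbij; exact: Prop_irrelevance.
Qed.

Definition selfbij_mul f g :=
  Selfbij (can_comp (fwdK f) (fwdK g)) (can_comp (bwdK g) (bwdK f)).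
Definition selfbij_one := @Selfbij T id id (frefl _) (frefl _).
Definition selfbij_inv f := Selfbij (bwdK f) (fwdK f).

Lemma selfbij_mulA : associative selfbij_mul.
Proof. by move=> f g h; exact: selfbij_ext. Qed.
Lemma selfbij_mul1g : left_id selfbij_one selfbij_mul.
Proof. by move=> f; exact: selfbij_ext. Qed.
Lemma selfbij_mulg1 : right_id selfbij_one selfbij_mul.
Proof. by move=> f; exact: selfbij_ext. Qed.
Lemma selfbij_mulVg : left_inverse selfbij_one selfbij_inv selfbij_mul.
Proof. by move=> f; apply: selfbij_ext => x; exact: fwdK. Qed.
Lemma selfbij_mulgV : right_inverse selfbij_one selfbij_inv selfbij_mul.
Proof. by move=> f; apply: selfbij_ext => x; exact: bwdK. Qed.

HB.instance Definition _ := isGroup.Build (selfbij T)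
  selfbij_mulA selfbij_mul1g selfbij_mulg1 selfbij_mulVg selfbij_mulgV.

End SelfBijections.

(** * Elementary matrices as shears *)

Section Shears.
Variables (I : eqType) (M : zmodType).
Implicit Types (f g : M -> M) (i j k l : I) (x : I -> M).

(** For [i != j] this is the elementary matrix e_ij(f) acting on column vectors, with a self-map of
    [M] as entry. *)
Definition shear_fun i j f x : I -> M :=
  fun m => if m == i then x i + f (x j) else x m.

Lemma shear_funK i j f : i != j ->
  cancel (shear_fun i j f) (shear_fun i j (fun z => - f z)).
Proof.
move=> ij x; apply/funext => m.
rewrite /shear_fun eqxx [j == i]eq_sym (negPf ij).
by case: (m =P i) => // ->; rewrite addrK.
Qed.

Lemma shear_funVK i j f : i != j ->
  cancel (shear_fun i j (fun z => - f z)) (shear_fun i j f).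
Proof.
move=> ij x; apply/funext => m.
rewrite /shear_fun eqxx [j == i]eq_sym (negPf ij).
by case: (m =P i) => // ->; rewrite subrK.
Qed.

Definition shear i j (ij : i != j) f : selfbij (I -> M) :=
  Selfbij (shear_funK f ij) (shear_funVK f ij).

Lemma shear_commute i j k l (ij : i != j) (kl : k != l) f g :
  j != k -> i != l -> commute (shear ij f) (shear kl g).
Proof.
move=> jk il; apply: selfbij_ext => x; apply/funext => m /=.
rewrite /shear_fun /= (negPf jk) [l == i]eq_sym (negPf il).
case: (eqVneq m i) => [->|mi]; last by case: (eqVneq m k) mi => // -> /negPf->.
by case: (eqVneq i k) => [<-|//]; rewrite addrAC.
Qed.

(** The Steinberg relation, checked in the form e_ij(f) e_jk(g) = e_jk(g) e_ij(f) e_ik(fg). *)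
Lemma shear_commutator i j k (ij : i != j) (jk : j != k) (ik : i != k) f g :
  {morph f : u v / u + v} ->
  [~ shear ij f, shear jk g]%g = shear ik (f \o g).
Proof.
move=> fD; apply: (mulgI (shear jk g * shear ij f)%g); rewrite -commgC.
apply: selfbij_ext => x; apply/funext => m /=.
rewrite /shear_fun /= !eqxx [k == i]eq_sym (negPf ik).
rewrite [j == i]eq_sym (negPf ij).
case: (eqVneq m i) => [->|_] //; rewrite (negPf ij) fD.
by rewrite -addrA [f (g _) + _]addrC.
Qed.

Lemma shear_expg i j (ij : i != j) f n x :
  (shear ij f ^+ n)%g x = shear_fun i j (fun z => f z *+ n) x.
Proof.
elim: n x => [|n IHn] x.
  by apply/funext => m; rewrite /shear_fun addr0; case: eqP => // ->.
rewrite expgS /= IHn; apply/funext => m; rewrite /shear_fun eqxx.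
rewrite [j == i]eq_sym (negPf ij).
by case: eqP => // _; rewrite mulrSr addrA.
Qed.

Lemma diag_funK (th th' : M -> M) : cancel th th' ->
  cancel (fun x : I -> M => th \o x) (fun x => th' \o x).
Proof. by move=> thK x; apply/funext => m /=. Qed.

Definition diag (th : selfbij M) : selfbij (I -> M) :=
  Selfbij (diag_funK (fwdK th)) (diag_funK (bwdK th)).

Lemma diag_shear (th : selfbij M) i j (ij : i != j) f g :
  {morph th : u v / u + v} -> (forall z, th (f z) = g (th z)) ->
  (diag th * shear ij f = shear ij g * diag th)%g.
Proof.
move=> thD thf; apply: selfbij_ext => x; apply/funext => m /=.
by rewrite /shear_fun; case: eqP => // _; rewrite thD thf.
Qed.

End Shears.

(** * Index maps for the invertible substitution *)

Definition pullback (S M : Type) (r : S -> S) (m : S -> M) : S -> M := m \o r.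

Lemma pullbackK (S M : Type) (r r' : S -> S) : cancel r' r ->
  cancel (@pullback S M r) (pullback r').
Proof. by move=> r'K m; apply/funext => q; rewrite /pullback /= r'K. Qed.

Definition pullback_bij (S M : Type) (r : selfbij S) : selfbij (S -> M) :=
  Selfbij (@pullbackK S M _ _ (bwdK r)) (@pullbackK S M _ _ (fwdK r)).

(* [F_17[X]] is replaced by functions on [nat * nat], with [X] acting by
   [shift], so that the substitution [X |-> X^2] becomes invertible: [halve]
   sends the even and odd indices of level [k] to levels [2k] and [2k + 1]. *)
Definition shift (q : nat * nat) := (q.1.+1, q.2).

Definition halve (q : nat * nat) := (q.1./2, q.2.*2 + odd q.1)%N.
Definition unhalve (q : nat * nat) := (q.1.*2 + odd q.2, q.2./2)%N.

Lemma halveK : cancel halve unhalve.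
Proof. by case=> n k; rewrite /halve /unhalve /=; congr (_, _); lia. Qed.

Lemma unhalveK : cancel unhalve halve.
Proof. by case=> n k; rewrite /halve /unhalve /=; congr (_, _); lia. Qed.

Definition halve_bij := Selfbij halveK unhalveK.

(** On pullbacks, with [T] for [shift] and [th] for [halve], this reads [th T = T^2 th]. *)
Lemma halve_shift2 q : shift (halve q) = halve (shift (shift q)).
Proof. by case: q => n k; rewrite /halve /shift /= negbK. Qed.

(** Its pullback commutes with that of [shift], but not with the square root [th^-1 T th], whose
    index map sends (n, 0) to (n, 1) and (n, 1) to (n + 1, 0). *)
Definition swap_levels (q : nat * nat) :=
  (q.1, if q.2 is 0 then 1%N else if q.2 is 1 then 0%N else q.2).

Lemma swap_levelsK : involutive swap_levels.
Proof. by case=> n [|[|k]]. Qed.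

Definition swap_bij := Selfbij swap_levelsK swap_levelsK.

(** * The system of equations *)

Definition comm_word u v := Mul (Inv u) (Mul (Inv v) (Mul u v)).
Definition commute_eq u v := (Mul u v, Mul v u).

Definition triangle_eqs : seq (word * word) :=
  let: (a, b, c, t, y) := (Var 0, Var 1, Var 2, Var 3, Var 4) in
  let: (ab, bc, ca) := (comm_word a b, comm_word b c, comm_word c a) in
  let one := Exp a 0 in
  [:: (Exp a 17, one); (Exp b 17, one); (Exp c 17, one);
      (Exp ab 17, one); commute_eq ab a; commute_eq ab b;
      (Exp bc 17, one); commute_eq bc b; commute_eq bc c;
      (Exp ca 17, one); commute_eq ca c; commute_eq ca a;
      commute_eq t a; commute_eq t b; (Mul t c, Mul (comm_word ca bc) t);
      commute_eq y a; commute_eq y b; commute_eq y c].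

(** In the model this is e_20 of a square root of X. *)
Definition triangle_root := Mul (Mul (Inv (Var 3)) (Var 2)) (Var 3).

Lemma triangle_not_haagerup (R : realType) (G : groupType) (rho : nat -> G) :
  holds rho triangle_eqs ->
  eval rho (Mul (Var 4) triangle_root)
  <> eval rho (Mul triangle_root (Var 4)) ->
  ~ haagerup R G.
Proof.
move=> [a17 [b17 [c17 [ab17 [aba [abb [bc17 [bcb [bcc [ca17 [cac [caa
  [ta [tb [tc [ya [yb [yc _]]]]]]]]]]]]]]]]]] yN haag.
apply: (self_similar_infinite ta tb tc ya yb yc yN).
exact: (haagerup_generated_finite haag a17 b17 c17
  (And3 ab17 aba abb) (And3 bc17 bcb bcc) (And3 ca17 cac caa)).
Qed.

(** * A solution of the system over F_17 *)

Section Model.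

Let M := (nat * nat -> 'F_17)%type.
Let n01 : (0 : 'I_3) != 1 := isT.
Let n12 : (1 : 'I_3) != 2 := isT.
Let n20 : (2 : 'I_3) != 0 := isT.
Let n02 : (0 : 'I_3) != 2 := isT.
Let n10 : (1 : 'I_3) != 0 := isT.
Let n21 : (2 : 'I_3) != 1 := isT.
Let T : M -> M := pullback shift.
Let th : selfbij M := pullback_bij 'F_17 halve_bij.
Let ups : selfbij M := pullback_bij 'F_17 swap_bij.

Definition model_assignment (n : nat) : selfbij ('I_3 -> M) :=
  nth 1%g [:: shear n01 id; shear n12 id; shear n20 T;
              diag 'I_3 th; diag 'I_3 ups] n.

Lemma shear_exp17 i j (ij : i != j :> 'I_3) (f : M -> M) :
  (shear ij f ^+ 17)%g = 1%g.
Proof.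
apply: selfbij_ext => x; rewrite shear_expg; apply/funext => m.
rewrite /shear_fun; case: eqP => //= ->.
apply/funext => q; rewrite addrfctE natmulfctE.
by rewrite -mulr_natl (_ : 17%:R = 0) ?mul0r ?addr0//; exact/eqP.
Qed.

Lemma model_holds : holds model_assignment triangle_eqs.
Proof.
have e17 := shear_exp17.
(* The commutator is a shear from [k] to [i], which commutes with both factors. *)
have pair i j k (ij : i != j :> 'I_3) (jk : j != k) (ik : i != k)
    (f g : M -> M) :
    {morph f : u v / u + v} -> heisenberg_pair 17 (shear ij f) (shear jk g).
  move=> fD; rewrite /heisenberg_pair (shear_commutator _ _ ik)//.
  split; first exact: e17.
    by apply: shear_commute => //; rewrite eq_sym.
  by apply: shear_commute => //; rewrite eq_sym.
have [ab17 aba abb] := pair _ _ _ n01 n12 n02 id id (fun _ _ => erefl).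
have [bc17 bcb bcc] := pair _ _ _ n12 n20 n10 id T (fun _ _ => erefl).
have [ca17 cac caa] := pair _ _ _ n20 n01 n21 T id (fun _ _ => erefl).
have t_id i j (ij : i != j :> 'I_3) : commute (diag 'I_3 th) (shear ij id).
  exact: diag_shear.
have y_lin i j (ij : i != j :> 'I_3) (f : M -> M) :
    (forall z, ups (f z) = f (ups z)) -> commute (diag 'I_3 ups) (shear ij f).
  exact: diag_shear.
(* The inner commutators are e_21(T) and e_10(T), and theirs is e_20(T^2). *)
have tc : (diag 'I_3 th * shear n20 T =
    [~ [~ shear n20 T, shear n01 id], [~ shear n12 id, shear n20 T]]
    * diag 'I_3 th)%g.
  rewrite (shear_commutator _ _ n21)// (shear_commutator _ _ n10)//.
  rewrite (shear_commutator _ _ n20)//; apply: diag_shear => // z.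
  apply/funext => q; exact: (congr1 z (halve_shift2 q)).
do 3 (split; first exact: e17).
split; first exact: ab17.
split; first exact: aba.
split; first exact: abb.
split; first exact: bc17.
split; first exact: bcb.
split; first exact: bcc.
split; first exact: ca17.
split; first exact: cac.
split; first exact: caa.
split; first exact: t_id.
split; first exact: t_id.
split; first exact: tc.
split; first exact: y_lin.
split; first exact: y_lin.
by split; first exact: y_lin.
Qed.

Lemma model_not_commute :
  eval model_assignment (Mul (Var 4) triangle_root)
  <> eval model_assignment (Mul triangle_root (Var 4)).
Proof.
(* From (0, 0), swapping first and then applying the index map of the square root leads to (1, 0),
   while the other order leads to (0, 0). The indicator of (1, 0) therefore takes the values 1 and
   0. *)
pose m : M := fun q => if q == (1, 0)%N then 1 else 0.
pose x : 'I_3 -> M := fun i => if i == 0 then m else 0.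
move=> /(congr1 (fun f : selfbij ('I_3 -> M) => f x 2 (0, 0)%N)).
rewrite /= /shear_fun /= !addrfctE /T /pullback /x /m /=.
Show.
by rewrite !add0r => /eqP.
Qed.

End Model.

Theorem proposition2p2p6 (R : realType) (G : groupType) :
  locally_universal G -> ~ haagerup R G.
Proof.
move=> luG; have [sigma [sigma_eqs sigma_neq]] :=
  locally_universal_transfer luG model_holds model_not_commute.
exact: triangle_not_haagerup sigma_eqs sigma_neq.
Qed.
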